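(* Let $K$ be a field of characteristic $0$, let $\alpha \in K$, and let $n$ be a positive integer. If $f(t) \in K[t]$ is a factor of $t^n - \alpha$ over $K$, then $\lambda_K(\alpha, n)$ divides $\deg f(t)$.
   Context: For a field $K$, an element $\alpha \in K$ and a positive integer $n$, $\lambda_K(\alpha,n)$ denotes the minimal degree of an irreducible factor of $t^n - \alpha$ in $K[t]$. *)

(* Defs.v *)
From HB Require Import structures.
From mathcomp Require Import all_boot all_order all_algebra.
From Stdlib Require Import ClassicalDescription.
Set Implicit Arguments. Unset Strict Implicit. Unset Printing Implicit Defensive.
Import GRing.Theory.
Local Open Scope ring_scope.

Definition irr_factor_deg (K : fieldType) (a : K) (n d : nat) : Prop :=
  exists p : {poly K},
    [/\ irreducible_poly p, p %| 'X^n - a%:P & (size p).-1 = d].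

Definition irr_factor_degb (K : fieldType) (a : K) (n : nat) : pred nat :=
  fun d => if excluded_middle_informative (irr_factor_deg a n d) then true else false.

(* lambda_K(a, n): minimal degree of an irreducible factor of t^n - a in K[t]
   (set to 0 when there is no irreducible factor, which cannot happen for n > 0). *)
Definition lambdaK (K : fieldType) (a : K) (n : nat) : nat :=
  match excluded_middle_informative (exists d, irr_factor_degb a n d) with
  | left H => ex_minn H
  | right _ => 0%N
  end.

(* Main.v *)
(** Prime powers first, [n = p ^ e] with [a != 0].  If [K] contains a primitive
    [p]-th root of unity, every root [x] of [t^n - a] is reached by a tower of
    extensions of degree 1 or [p], so all irreducible factors have degree a
    power of [p] and the minimal degree divides the others.  Otherwise, taking
    norms in a factor of degree [d] shows that [a ^ d] is an [n]-th power, hence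
    so is [a ^ (p ^ k)] with [p ^ k = gcd(d, n)]; as [K] has no nontrivial root
    of unity of [p]-power order, [a = c ^ (p ^ (e - k))] and [t^(p ^ k) - c] is a
    factor, whence [lambda <= gcd(d, n)] for every [d].
    The general case follows since [lambda(a, m n) = lambda(a, m) lambda(a, n)]
    for coprime [m], [n]: a root [y] of [t^(m n) - a] amounts to a root [y^n] of
    [t^m - a] together with a root [y^m] of [t^n - a]. *)
Require Import Defs.
From mathcomp Require Import all_boot all_order all_algebra all_field.
From mathcomp Require Import zify.
From Stdlib Require Import ClassicalDescription.
Set Implicit Arguments.
Unset Strict Implicit.
Unset Printing Implicit Defensive.
Import GRing.Theory.
Local Open Scope ring_scope.

(** * Norms of roots of [t^n - a], computed as determinants *)

Lemma det_exp_of_char_poly (K : fieldType) d (A : 'M[K]_d) (a : K) n :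
  char_poly A %| 'X^n - a%:P -> \det A ^+ n = a ^+ d.
Proof.
case: d A => [|d] A; first by rewrite det_mx00 expr1n expr0.
case/dvdpP => q eq_q.
have /eqP : horner_mx A ('X^n - a%:P) = 0.
  by rewrite eq_q rmorphM /= Cayley_Hamilton mulr0.
rewrite rmorphB rmorphXn /= horner_mx_X horner_mx_C subr_eq0 => /eqP An.
have <- : \det (A ^+ n) = a ^+ d.+1 by rewrite An det_scalar.
elim: n {eq_q An} => [|n IHn].
  by rewrite !expr0 det1.
by rewrite exprS IHn -det_mulmx [in RHS]exprS.
Qed.

(** The companion matrix of [f] has determinant [(-1)^d f(0)], the product of the roots of [f]; this
    stands in for the norm without a splitting field. *)
Lemma coef0_exp_of_dvd_XnsubC (K : fieldType) (f : {poly K}) (a : K) n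
  (d := (size f).-1) :
  f \is monic -> f %| 'X^n - a%:P -> ((-1) ^+ d * f`_0) ^+ n = a ^+ d.
Proof.
move=> fM fD; have cf := companionmxK fM.
rewrite -[in f`_0]cf char_poly_det mulrA -exprMn mulrNN mulr1 expr1n mul1r.
by apply: det_exp_of_char_poly; rewrite cf.
Qed.

(** Bezout: with [u d = v n + gcd(d, n)], [c^(u n) = a^(u d)], and dividing by [a^(v n)] leaves the
    gcd. *)
Lemma exp_gcdn_of_exp (K : fieldType) (a c : K) n d :
  (0 < d)%N -> a != 0 -> c ^+ n = a ^+ d ->
  exists u v, (c ^+ u / a ^+ v) ^+ n = a ^+ gcdn d n.
Proof.
move=> d_gt0 a0 cn; case: (egcdnP n d_gt0) => u v uv _; exists u, v.
rewrite exprMn exprVn -!exprM mulnC exprM cn -exprM mulnC uv exprD.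
by rewrite mulrAC divff ?mul1r // expf_neq0.
Qed.

(** * Irreducible factors and the minimality of [lambdaK] *)

Lemma irr_factor_exists (K : fieldType) (f : {poly K}) :
  (1 < size f)%N -> exists2 q, irreducible_poly q & q %| f.
Proof.
elim: {f}(size f) {-2}f (leqnn (size f)) => [|s IHs] f szf f1.
  by rewrite ltnNge (leq_trans szf) in f1.
have [//|redf] := excluded_middle_informative (irreducible_poly f).
  by exists f.
have [[q [q1 qf nqf]]|nex] := excluded_middle_informative
   (exists q : {poly K}, [/\ size q != 1%N, q %| f & ~~ (q %= f)]); last first.
  case: redf; split=> // q q1 qf; apply/negPn/negP => nqf.
  by case: nex; exists q.
have f0 : f != 0 by rewrite -size_poly_gt0 ltnW.
have q0 : q != 0 by apply: contraTneq qf => ->; rewrite dvd0p.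
have q_gt1 : (1 < size q)%N by rewrite ltn_neqAle eq_sym q1 size_poly_gt0.
have [|r irr_r rq] := IHs q _ q_gt1.
  rewrite -ltnS (leq_trans _ szf) // ltn_neqAle dvdp_leq // andbT.
  by rewrite dvdp_size_eqp.
by exists r => //; apply: dvdp_trans qf.
Qed.

(** For [n > 0] the minimum is attained and the default value [0] never arises. *)
Lemma lambdaK_irr (K : fieldType) (a : K) n :
  (0 < n)%N -> irr_factor_deg a n (lambdaK a n).
Proof.
move=> n0; rewrite /lambdaK; case: excluded_middle_informative => [ex|[]].
  case: ex_minnP => d; rewrite /irr_factor_degb.
  by case: excluded_middle_informative.
have [|q irr_q qD] := @irr_factor_exists _ ('X^n - a%:P).
  by rewrite size_XnsubC.
exists (size q).-1; rewrite /irr_factor_degb.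
by case: excluded_middle_informative => // -[]; exists q.
Qed.

Lemma lambdaK_le (K : fieldType) (a : K) n d :
  irr_factor_deg a n d -> (lambdaK a n <= d)%N.
Proof.
move=> irr_d; rewrite /lambdaK; case: excluded_middle_informative => // ex.
case: ex_minnP => m _; apply; rewrite /irr_factor_degb.
by case: excluded_middle_informative.
Qed.

Lemma irr_factor_deg_gt0 (K : fieldType) (a : K) n d :
  irr_factor_deg a n d -> (0 < d)%N.
Proof. by case=> p [[p_gt1 _] _ <-]; rewrite -ltnS (ltn_predK p_gt1). Qed.

Lemma lambdaK_le_dvdp (K : fieldType) (a : K) n (f : {poly K}) :
  (1 < size f)%N -> f %| 'X^n - a%:P -> (lambdaK a n <= (size f).-1)%N.
Proof.
move=> f1 fD; have [q irr_q qf] := irr_factor_exists f1.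
have f0 : f != 0 by rewrite -size_poly_gt0 ltnW.
apply: (@leq_trans (size q).-1).
  by apply: lambdaK_le; exists q; split=> //; apply: dvdp_trans fD.
by rewrite -!subn1 leq_sub2r // dvdp_leq.
Qed.

(** * Degrees of irreducible factors as degrees of simple extensions *)

Lemma dim_adjoin1 (K : fieldType) (L : fieldExtType K) (x : L) :
  \dim <<1; x>> = adjoin_degree 1%AS x.
Proof. by rewrite dim_Fadjoin dimv1 muln1. Qed.

Lemma irr_factor_deg_root (K : fieldType) (L : fieldExtType K) (x : L) (a : K) n :
  x ^+ n = a%:A -> irr_factor_deg a n (\dim <<1; x>>).
Proof.
move=> xn; have /polyOver1P[p def_p] := minPolyOver 1%AS x.
have sz_p : size p = (adjoin_degree 1%AS x).+1.
  by rewrite -size_minPoly def_p size_map_poly.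
exists p; split; last by rewrite dim_adjoin1 sz_p.
- split=> [|q q1 qp]; first by rewrite sz_p.
  have Kq : map_poly (in_alg L) q \is a polyOver 1%AS.
    by apply/polyOver1P; exists q.
  have := @minPoly_irr _ _ _ x _ Kq; rewrite def_p dvdp_map => /(_ qp).
  rewrite -(rmorph1 (map_poly (in_alg L))) !eqp_map.
  by rewrite -[q %= 1]size_poly_eq1 (negPf q1) orbF.
rewrite -(dvdp_map (in_alg L)) -def_p; apply: minPoly_dvdp.
  by apply/polyOver1P; exists ('X^n - a%:P).
by rewrite rmorphB /= map_polyXn map_polyC /= rootE !hornerE xn subrr.
Qed.

Lemma irr_factor_deg_ext (K : fieldType) (a : K) n d :
  irr_factor_deg a n d ->
  exists (L : fieldExtType K) (x : L),
    [/\ \dim {:L} = d, <<1; x>>%VS = fullv & x ^+ n = a%:A].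
Proof.
case=> p [irr_p pD <-]; have [L dimL [z rz zL]] := irredp_FAdjoin irr_p.
exists L, z; split=> //; move: pD; rewrite -(dvdp_map (in_alg L)) => pD.
have := dvdp_trans _ pD; move: rz; rewrite -!dvdp_XsubCl => rz /(_ _ rz).
rewrite dvdp_XsubCl rmorphB /= map_polyXn map_polyC /= rootE !hornerE subr_eq0.
by move/eqP.
Qed.

(** * Prime power exponents *)

Lemma primitive_root_prime (K : fieldType) (z : K) p :
  prime p -> z != 1 -> z ^+ p = 1 -> p.-primitive_root z.
Proof.
move=> p_pr z1 zp; have [m prim_z] := prim_order_exists (prime_gt0 p_pr) zp.
case/primeP: p_pr => _ /[apply] /orP[] /eqP m_eq; rewrite m_eq in prim_z => //.
by rewrite -(prim_expr_order prim_z) expr1 eqxx in z1.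
Qed.

(* The norm of [x] is [c], with [c ^ p = (x ^ p) ^ d]; if [p] does not
   divide [d], then [x ^ p] is the [p]-th power of some [y] in [E] and [x / y]
   is a power of [z]. *)
Lemma adjoin_degree_prime_root (K : fieldType) (L : fieldExtType K)
    (E : {subfield L}) (x z : L) p :
  prime p -> p.-primitive_root z -> z \in E -> x != 0 -> x ^+ p \in E ->
  p.-nat (adjoin_degree E x).
Proof.
move=> p_pr prim_z zE x0 xpE; set d := adjoin_degree E x.
have p_gt0 := prime_gt0 p_pr.
have d_gt0 : (0 < d)%N by [].
have fD : minPoly E x %| 'X^p - (x ^+ p)%:P.
  apply: minPoly_dvdp; first by rewrite polyOverXnsubC.
  by rewrite rootE !hornerE subrr.
have := coef0_exp_of_dvd_XnsubC (monic_minPoly E x) fD.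
rewrite size_minPoly /= -/d; set c := _ * _ => cp.
have cE : c \in E.
  by rewrite rpredM ?rpredX ?rpredN ?rpred1 ?(polyOverP (minPolyOver E x)).
(* [minPoly E x] divides [t^p - x^p], so [d <= p]; hence [p %| d] forces [d = p]. *)
have [p_d|p'd] := boolP (p %| d)%N.
  suff /eqP-> : d == p by rewrite pnat_id.
  rewrite eqn_leq [(p <= d)%N]dvdn_leq // andbT -ltnS -size_minPoly.
  by rewrite -(size_XnsubC (x ^+ p) p_gt0) dvdp_leq // monic_neq0 ?monicXnsubC.
have [u [v]] := exp_gcdn_of_exp d_gt0 (expf_neq0 p x0) cp.
set y := _ / _; have yE : y \in E by apply: rpred_div; apply: rpredX.
have /eqP -> : coprime d p by rewrite coprime_sym prime_coprime.
rewrite expr1 => yp.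
have y0 : y != 0.
  apply: contraNneq x0 => y0; move/eqP: yp.
  by rewrite y0 expr0n gtn_eqF // eq_sym expf_eq0 p_gt0.
have [|i xy] := prim_rootP prim_z (_ : (x / y) ^+ p = 1).
  by rewrite exprMn exprVn yp divff // expf_neq0.
suff : x \in E by rewrite -adjoin_deg_eq1 /d => /eqP->.
by rewrite -(divfK y0 x) xy rpredM ?rpredX.
Qed.

(** Induction on [e]: [K(x)] lies in [K(x^p)(x)], whose degree over [K] is the product of two powers
    of [p]. *)
Lemma pnat_dim_adjoin_root (K : fieldType) (L : fieldExtType K) (z : K) p e
    (x : L) :
  prime p -> p.-primitive_root z -> x != 0 -> x ^+ (p ^ e) \in 1%VS ->
  p.-nat (\dim <<1; x>>).
Proof.
move=> p_pr prim_z; elim: e x => [|e IHe] x x0.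
  by rewrite expr1 dim_adjoin1 -adjoin_deg_eq1 => /eqP->.
rewrite expnS exprM => /IHe; rewrite expf_neq0 // => /(_ isT) dim_xp.
have prim_zL : p.-primitive_root (in_alg L z) by rewrite fmorph_primitive_root.
have zE : (z%:A : L) \in <<1; x ^+ p>>%VS.
  by rewrite (subvP (subv_adjoin _ _)) // rpredZ ?rpred1.
have deg := adjoin_degree_prime_root p_pr prim_zL zE x0 (memv_adjoin _ _).
apply: (@pnat_dvd _ (\dim <<<<1; x ^+ p>>; x>>)); last first.
  by rewrite dim_Fadjoin pnatM deg.
apply: field_dimS; apply/FadjoinP; split; last exact: memv_adjoin.
exact: sub1v.
Qed.

Lemma expp_eq1_inj (K : fieldType) p e (x : K) :
  (forall z : K, z ^+ p = 1 -> z = 1) -> x ^+ (p ^ e) = 1 -> x = 1.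
Proof.
move=> mu_p; elim: e => [|e IHe]; first by rewrite expr1.
by rewrite expnSr exprM => /mu_p.
Qed.

Lemma lambdaK_dvd_no_root (K : fieldType) (a : K) p e :
  prime p -> a != 0 -> (forall z : K, z ^+ p = 1 -> z = 1) ->
  p.-nat (lambdaK a (p ^ e)) /\
  (forall d, irr_factor_deg a (p ^ e) d -> (lambdaK a (p ^ e) %| d)%N).
Proof.
move=> p_pr a0 mu_p; set n := (p ^ e)%N.
have n_gt0 : (0 < n)%N by rewrite expn_gt0 prime_gt0.
have le_gcd d : irr_factor_deg a n d -> (lambdaK a n <= gcdn d n)%N.
  move=> irr_d; have d_gt0 := irr_factor_deg_gt0 irr_d.
  case: irr_d => f [irr_f fD sz_f]; have f0 := irredp_neq0 irr_f.
  have lf0 : (lead_coef f)^-1 != 0 by rewrite invr_eq0 lead_coef_eq0.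
  pose g := (lead_coef f)^-1 *: f.
  have gM : g \is monic by rewrite monicE lead_coefZ mulVf // lead_coef_eq0.
  have gD : g %| 'X^n - a%:P by rewrite dvdpZl.
  have := coef0_exp_of_dvd_XnsubC gM gD; rewrite size_scale // sz_f => cn.
  have [u [v]] := exp_gcdn_of_exp d_gt0 a0 cn.
  set c := _ / _; have /(dvdn_pfactor _ _ p_pr)[k ke ->] := dvdn_gcdr d n.
  (* Since [c^(p^e) = a^(p^k)], the quotient [a / c^(p^(e-k))] has [p^k]-th power 1, so it is 1. *)
  move=> {}cn; have ac : a = c ^+ (p ^ (e - k)).
    have c0 : c != 0.
      apply: contraNneq a0 => c0; move/eqP: cn.
      by rewrite c0 expr0n gtn_eqF // eq_sym expf_eq0 => /andP[].
    apply: (mulIf (invr_neq0 (expf_neq0 (p ^ (e - k)) c0))).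
    rewrite divff ?expf_neq0 //; apply: (@expp_eq1_inj _ p k) => //.
    by rewrite exprMn exprVn -cn -exprM -expnD subnK // divff // expf_neq0.
  have k0 : (0 < p ^ k)%N by rewrite expn_gt0 prime_gt0.
  have -> : (p ^ k)%N = (size ('X^(p ^ k) - c%:P)).-1 by rewrite size_XnsubC.
  apply: lambdaK_le_dvdp; first by rewrite size_XnsubC.
  rewrite /n -(subnKC ke) expnD exprM [in a%:P]ac rmorphXn /=.
  by rewrite subrXX dvdp_mulr.
have irr_l := lambdaK_irr a n_gt0.
(* The bound applied to [lambdaK a n] itself makes it a divisor of [n], hence a power of [p]. *)
have eq_l : lambdaK a n = gcdn (lambdaK a n) n.
  apply/eqP; rewrite eqn_leq le_gcd // dvdn_leq ?dvdn_gcdl //.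
  exact: irr_factor_deg_gt0 irr_l.
have nat_n : p.-nat n by rewrite pnatX pnat_id.
have dvd_n : (lambdaK a n %| n)%N by rewrite eq_l dvdn_gcdr.
split=> [|d irr_d]; first exact: pnat_dvd nat_n.
(* Two powers of [p] are compared by size, so the inequality becomes a divisibility. *)
have le_d := le_gcd d irr_d; move: dvd_n (dvdn_gcdr d n) le_d.
case/(dvdn_pfactor _ _ p_pr)=> i _ -> /(dvdn_pfactor _ _ p_pr)[j _ eq_j].
rewrite eq_j leq_exp2l ?prime_gt1 // => ij.
by rewrite (dvdn_trans _ (dvdn_gcdl d n)) // eq_j dvdn_exp2l.
Qed.

Lemma lambdaK_dvd_prime_power (K : fieldType) (a : K) p e :
  prime p -> a != 0 ->
  p.-nat (lambdaK a (p ^ e)) /\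
  (forall d, irr_factor_deg a (p ^ e) d -> (lambdaK a (p ^ e) %| d)%N).
Proof.
move=> p_pr a0; have [mu_p|nmu_p] := excluded_middle_informative
  (forall z : K, z ^+ p = 1 -> z = 1); first exact: lambdaK_dvd_no_root.
have [[z [zp z1]]|nex] := excluded_middle_informative
  (exists z : K, z ^+ p = 1 /\ z != 1); last first.
  by case: nmu_p => z zp; apply/eqP/negPn/negP => z1; case: nex; exists z.
have prim_z := primitive_root_prime p_pr z1 zp.
have n_gt0 : (0 < p ^ e)%N by rewrite expn_gt0 prime_gt0.
have nat_d d : irr_factor_deg a (p ^ e) d -> p.-nat d.
  case/irr_factor_deg_ext=> L [x [<- <- xn]].
  apply: (pnat_dim_adjoin_root (e := e) p_pr prim_z).
    apply: contraNneq a0 => x0; move/eqP: xn.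
    by rewrite x0 expr0n gtn_eqF // eq_sym scaler_eq0 oner_eq0 orbF.
  by rewrite xn rpredZ ?rpred1.
have irr_l := lambdaK_irr a n_gt0; split=> [|d irr_d]; first exact: nat_d.
have := lambdaK_le irr_d.
have [/p_natP[i ->] /p_natP[j ->]] := (nat_d _ irr_l, nat_d _ irr_d).
by rewrite leq_exp2l ?prime_gt1 // => /dvdn_exp2l->.
Qed.

(** * Coprime exponents *)

(** Adjoin first an [m]-th root of [a], then an [n]-th root, each of least degree; the top field
    contains an [(m n)]-th root of [a]. *)
Lemma lambdaK_le_coprime (K : fieldType) (a : K) m n :
  (0 < m)%N -> (0 < n)%N -> coprime m n -> a != 0 ->
  (lambdaK a (m * n) <= lambdaK a m * lambdaK a n)%N.
Proof.
move=> m_gt0 n_gt0 /eqP co_mn a0.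
have [L1 [x [dim1 _ xm]]] := irr_factor_deg_ext (lambdaK_irr a m_gt0).
pose a1 : L1 := a%:A.
(* A factor over [K] is still a factor over [L1], though possibly reducible. *)
have le_n : (lambdaK a1 n <= lambdaK a n)%N.
  have irr_n := lambdaK_irr a n_gt0; have d_gt0 := irr_factor_deg_gt0 irr_n.
  case: irr_n => q [_ qD sz_q]; rewrite -sz_q -(size_map_poly (in_alg L1)).
  apply: lambdaK_le_dvdp.
    by rewrite size_map_poly; case: (size q) sz_q d_gt0 => [<-|[<-|]].
  by move: qD; rewrite -(dvdp_map (in_alg L1)) rmorphB /= map_polyXn map_polyC.
have [L2 [w [dim2 _ wn]]] := irr_factor_deg_ext (lambdaK_irr a1 n_gt0).
have [u v uv _] := egcdnP n m_gt0; rewrite co_mn addn1 in uv.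
(* As [u m = v n + 1], [y^(m n) = a^(u m) / a^(v n) = a]. *)
pose y : L2 := w ^+ u / x%:A ^+ v.
have a2 : (a1%:A : L2) != 0 by rewrite !scaler_eq0 !oner_eq0 !orbF.
have ymn : y ^+ (m * n) = a1%:A.
  have xAm : (x%:A : L2) ^+ m = a1%:A by rewrite -(rmorphXn (in_alg L2)) xm.
  rewrite exprMn exprVn -!exprM [(v * _)%N]mulnCA [in x%:A ^+ _]exprM xAm.
  by rewrite [(m * n)%N]mulnC mulnCA exprM wn uv exprS mulfK // expf_neq0.
pose L : fieldExtType K := baseFieldType L2.
have := @irr_factor_deg_root K L y a _ ymn => /lambdaK_le/leq_trans; apply.
apply: (@leq_trans (\dim {:L})); first by rewrite dimvS ?subvf.
have -> : \dim {:L} = (\dim {:L2} * \dim {:L1})%N.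
  rewrite -dim_baseVspace; congr (\dim _).
  by apply/vspaceP => t; rewrite mem_baseVspace (memvf (t : L2)) (memvf (t : L)).
by rewrite dim1 dim2 mulnC leq_mul2l le_n orbT.
Qed.

(** For a root [x] of [t^(m n) - a], the subfields [K(x^n)] and [K(x^m)] have degrees divisible by
    the two coprime lambdas; so the product divides [[K(x) : K]]. *)
Lemma lambdaK_dvd_coprime (K : fieldType) (a : K) m n :
  (0 < m)%N -> (0 < n)%N -> coprime m n -> a != 0 ->
  coprime (lambdaK a m) (lambdaK a n) ->
  (forall d, irr_factor_deg a m d -> (lambdaK a m %| d)%N) ->
  (forall d, irr_factor_deg a n d -> (lambdaK a n %| d)%N) ->
  lambdaK a (m * n) = (lambdaK a m * lambdaK a n)%N /\
  (forall d, irr_factor_deg a (m * n) d -> (lambdaK a (m * n) %| d)%N).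
Proof.
move=> m_gt0 n_gt0 co_mn a0 co_l dvd_m dvd_n.
have mn_gt0 : (0 < m * n)%N by rewrite muln_gt0 m_gt0.
have dvd_mn d : irr_factor_deg a (m * n) d ->
    (lambdaK a m * lambdaK a n %| d)%N.
  case/irr_factor_deg_ext => L [x [<- _ xmn]]; rewrite Gauss_dvd //.
  apply/andP; split.
    apply: dvdn_trans (field_dimS (subvf <<1; x ^+ n>>)).
    by apply/dvd_m/irr_factor_deg_root; rewrite -exprM mulnC.
  apply: dvdn_trans (field_dimS (subvf <<1; x ^+ m>>)).
  by apply/dvd_n/irr_factor_deg_root; rewrite -exprM.
have irr_l := lambdaK_irr a mn_gt0.
suff eq_l : lambdaK a (m * n) = (lambdaK a m * lambdaK a n)%N.
  by split=> // d; rewrite eq_l; apply: dvd_mn.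
apply/eqP; rewrite eqn_leq lambdaK_le_coprime //= dvdn_leq ?dvd_mn //.
exact: irr_factor_deg_gt0 irr_l.
Qed.

Lemma lambdaK_eq1 (K : fieldType) (a c : K) n :
  (0 < n)%N -> c ^+ n = a -> lambdaK a n = 1%N.
Proof.
move=> n_gt0 cn; apply/eqP; rewrite eqn_leq.
rewrite (irr_factor_deg_gt0 (lambdaK_irr a n_gt0)) andbT.
apply: leq_trans (lambdaK_le_dvdp (f := 'X - c%:P) _ _) _;
  rewrite ?size_XsubC //.
by rewrite dvdp_XsubCl rootE !hornerE cn subrr.
Qed.

(** Strong induction on [n], splitting off the full power of its least prime factor; the claim on
    prime divisors is carried along to keep the two lambdas coprime. *)
Lemma lambdaK_dvd_irr (K : fieldType) (a : K) n :
  (0 < n)%N -> a != 0 ->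
  \pi(n).-nat (lambdaK a n) /\
  (forall d, irr_factor_deg a n d -> (lambdaK a n %| d)%N).
Proof.
move=> + a0; elim/ltn_ind: n => n IHn n_gt0.
have [n_gt1|n_le1] := ltnP 1 n; last first.
  have -> : n = 1%N by apply/eqP; rewrite eqn_leq n_le1.
  by rewrite (lambdaK_eq1 _ (expr1 a)) //; split=> // d _; rewrite dvd1n.
set p := pdiv n; have p_pr : prime p by apply: pdiv_prime.
have p_n : (p %| n)%N by apply: pdiv_dvd.
have [m p'm def_n] := pfactor_coprime p_pr n_gt0.
set e := logn p n in def_n.
have e_gt0 : (0 < e)%N by rewrite logn_gt0 mem_primes p_pr n_gt0.
have m_gt0 : (0 < m)%N by move: n_gt0; rewrite def_n muln_gt0 => /andP[].
have pe_gt0 : (0 < p ^ e)%N by rewrite expn_gt0 prime_gt0.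
have m_lt : (m < n)%N.
  by rewrite def_n ltn_Pmulr // -(exp1n e) ltn_exp2r // prime_gt1.
have [nat_p dvd_p] := lambdaK_dvd_prime_power e p_pr a0.
have [nat_m dvd_m] := IHn m m_lt m_gt0.
have co_l : coprime (lambdaK a m) (lambdaK a (p ^ e)).
  rewrite coprime_sym; apply: pnat_coprime nat_p _.
  apply: sub_in_pnat nat_m => q _; rewrite mem_primes !inE => /and3P[q_pr _ qm].
  by apply: contraTneq p'm => <-; rewrite prime_coprime // qm.
have co_mp : coprime m (p ^ e) by rewrite coprime_sym coprimeXl.
have [eq_l dvd_l] := lambdaK_dvd_coprime m_gt0 pe_gt0 co_mp a0 co_l dvd_m dvd_p.
rewrite def_n; split=> //; rewrite eq_l pnatM; apply/andP; split.
  apply: sub_in_pnat nat_m => q _; rewrite -def_n !mem_primes n_gt0 def_n.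
  by move=> /and3P[-> _ qm]; rewrite dvdn_mulr.
apply: sub_in_pnat nat_p => q _; rewrite -def_n inE => /eqP->.
by rewrite mem_primes p_pr n_gt0.
Qed.

Theorem theorem1p3 (K : fieldType) (hK : [pchar K] =i pred0) (a : K) (n : nat)
  (hn : (0 < n)%N) (f : {poly K}) (hf : f %| 'X^n - a%:P) :
  (lambdaK a n %| (size f).-1)%N.
Proof.
have dvd_irr d : irr_factor_deg a n d -> (lambdaK a n %| d)%N.
  have [a0|a0] := eqVneq a 0; last exact: (lambdaK_dvd_irr hn a0).2.
  (* For [a = 0], the linear polynomial [t] is a factor of [t^n]. *)
  by move=> _; rewrite (lambdaK_eq1 hn (c := 0)) ?dvd1n // expr0n gtn_eqF.
(* Induction on a bound for the size: peel off an irreducible factor [q], whose degree is a multiple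
   of lambda, and treat the cofactor [g], also a factor of [t^n - a]. *)
elim: {f}(size f) {-2}f (leqnn (size f)) hf => [|s IHs] f sz_f fD.
  by move: sz_f; rewrite leqn0 => /eqP->.
have [f1|] := ltnP 1 (size f); last by case: (size f) => [|[]].
have [q irr_q qf] := irr_factor_exists f1.
have lq : (lambdaK a n %| (size q).-1)%N.
  by apply: dvd_irr; exists q; split=> //; apply: dvdp_trans fD.
have q1 : (1 < size q)%N by case: irr_q.
have f0 : f != 0 by rewrite -size_poly_gt0 ltnW.
case/dvdpP: qf => g def_f; have : g * q != 0 by rewrite -def_f.
rewrite mulf_eq0 negb_or -!size_poly_gt0 => /andP[g_gt0 q_gt0].
have sz_gq : (size f).-1 = ((size g).-1 + (size q).-1)%N.
  rewrite def_f size_mul -?size_poly_gt0 //.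
  by case: (size g) (size q) g_gt0 q_gt0 => [|i] [|j] //; rewrite addnS addSn.
rewrite sz_gq dvdn_addl // IHs //; last first.
  by apply: dvdp_trans fD; rewrite def_f dvdp_mulr.
move: sz_f q1 g_gt0 sz_gq f1.
by case: (size f) (size g) (size q) => [|i] [|j] [|[|k]] //=; lia.
Qed.
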